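(* Let $b$ be a real number with $b \geq \tau = (1+\sqrt{5})/2$ and let $n \geq 2$ be an integer. Then $M_b(n) \in \{ |c_{0,0,n}|, |c_{1,1,n}| \}$.
   Context: For real numbers $a_0, \ldots, a_{n-1}$, $V(a_0, \ldots, a_{n-1})$ denotes the $n \times n$ Vandermonde matrix whose $(i,j)$ entry ($0 \leq i,j < n$, rows and columns indexed from $0$) is $a_i^j$. For a positive integer $n$ and a real number $b > 1$, the numbers $c_{i,j,n}$ ($0 \leq i,j < n$), depending on $b$, are the entries of the inverse matrix: $[c_{i,j,n}]_{0 \leq i,j < n} = V(b^0, b^1, \ldots, b^{n-1})^{-1}$, i.e. the inverse of $[b^{ij}]_{0 \leq i,j<n}$. Further, $M_b(n) = \max_{0 \leq i,j < n} |c_{i,j,n}|$. *)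

(* Defs.v *)
From HB Require Import structures.
From mathcomp Require Import all_boot all_order all_algebra.
From mathcomp Require Import reals.
Set Implicit Arguments.
Unset Strict Implicit.
Unset Printing Implicit Defensive.
Import Order.TTheory GRing.Theory Num.Theory.
Local Open Scope ring_scope.

(* The library's [Vandermonde n a] has (i, j) entry [a 0 j ^+ i], so the
   matrix with (i, j) entry a_i^j is its transpose. *)
Definition vandermonde (R : realType) (n : nat) (a : 'rV[R]_n) : 'M[R]_n :=
  (Vandermonde n a)^T.

Definition powers (R : realType) (b : R) (n : nat) : 'rV[R]_n :=
  \row_(i < n) b ^+ i.

(* For b > 1 the points b^0, ..., b^(n-1) are distinct, so the matrix is
   invertible and [invmx] is its inverse. *)
Definition coef (R : realType) (b : R) (n : nat) (i j : 'I_n) : R :=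
  invmx (vandermonde (powers b n)) i j.

(* The terms are nonnegative, so for n > 0 the default value 0 of the iterated
   maximum does not affect it. *)
Definition maxcoef (R : realType) (b : R) (n : nat) : R :=
  \big[Num.max/0]_(i < n) \big[Num.max/0]_(j < n) `|coef b i j|.

Definition golden_ratio (R : realType) : R := (1 + Num.sqrt 5) / 2.

(* Main.v *)
Require Import Defs.
From mathcomp Require Import all_boot all_order all_algebra.
From mathcomp Require Import reals.
From mathcomp Require Import ring lra.
Set Implicit Arguments.
Unset Strict Implicit.
Unset Printing Implicit Defensive.
Import Order.TTheory GRing.Theory Num.Theory.
Local Open Scope ring_scope.

(** With [q = 1 / b], column [j] of the inverse consists of the coefficients of
    the Lagrange polynomial [K_j * \prod_(m != j) (1 - q^m X)], so [|c_{i,j}|] is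
    [|c_{0,j}|] times the elementary symmetric polynomial [e_i] of the [q^m],
    [m != j].  As [(k+1) e_(k+1) <= e_1 e_k] and [e_1 <= 1 / (1 - q) <= 3], we get
    [e_(k+1) <= e_k] for [k >= 2]; for [k = 1] one has the sharper bound
    [(1 + q) e_2 <= q e_1^2], whence [e_2 <= e_1] exactly because [q^2 + q <= 1].
    So a column attains its maximum in row 0 or 1, and by symmetry of the
    inverse the maximum is attained with [i, j <= 1].  Finally
    [|c_{0,1}| <= |c_{1,1}|], since [e_1] of the [q^m], [m != 1], is at least
    [q^0 = 1]. *)

(** Generating polynomial of the elementary symmetric polynomials: its coefficient of degree [k] is
    e_k of the entries of [s]. *)
Definition esymp (R : comNzRingType) (s : seq R) : {poly R} :=
  \prod_(x <- s) (1 + x *: 'X).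

Section ElementarySymmetric.
Variable R : realFieldType.
Implicit Types (s : seq R) (x q : R) (k : nat).

Lemma esymp_nil : esymp ([::] : seq R) = 1.
Proof. by rewrite /esymp big_nil. Qed.

Lemma coef0_esymp s : (esymp s)`_0 = 1.
Proof.
elim: s => [|x s IHs]; first by rewrite esymp_nil coef1.
by rewrite /esymp big_cons mulrDl mul1r -scalerAl coefD coefZ coefXM mulr0 addr0.
Qed.

Lemma coefS_esymp_cons x s k :
  (esymp (x :: s))`_k.+1 = (esymp s)`_k.+1 + x * (esymp s)`_k.
Proof. by rewrite /esymp big_cons mulrDl mul1r -scalerAl coefD coefZ coefXM. Qed.

Lemma size_esymp s : (size (esymp s) <= (size s).+1)%N.
Proof.
elim: s => [|x s IHs]; first by rewrite esymp_nil size_poly1.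
apply/leq_sizeP => -[|k] // ltsk; rewrite coefS_esymp_cons.
by rewrite !(leq_sizeP _ _ IHs) ?mulr0 ?addr0 // ltnW.
Qed.

Lemma coef_esympN s k :
  (esymp [seq - x | x <- s])`_k = (-1) ^+ k * (esymp s)`_k.
Proof.
elim: s k => [|x s IHs] [|k]; rewrite ?coef0_esymp ?mulr1 //.
  by rewrite esymp_nil coef1 mulr0.
by rewrite /= !coefS_esymp_cons !IHs exprS; ring.
Qed.

Lemma coef_esymp_ge0 s k : {in s, forall x, 0 <= x} -> 0 <= (esymp s)`_k.
Proof.
elim: s k => [|x s IHs] [|k] s0; rewrite ?coef0_esymp //.
  by rewrite esymp_nil coef1.
have s'0 : {in s, forall y, 0 <= y} by move=> y ys; rewrite s0 // inE ys orbT.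
by rewrite coefS_esymp_cons addr_ge0 ?mulr_ge0 ?IHs // s0 ?mem_head.
Qed.

(** Expanding e_1 e_k yields each squarefree monomial of degree k+1 exactly k+1 times, plus
    nonnegative terms with a repeated factor. *)
Lemma coefS_esymp_le s k : {in s, forall x, 0 <= x} ->
  k.+1%:R * (esymp s)`_k.+1 <= (esymp s)`_1 * (esymp s)`_k.
Proof.
elim: s k => [|x s IHs] k s0; first by rewrite esymp_nil !coef1 mulr0 mul0r.
have s'0 : {in s, forall y, 0 <= y} by move=> y ys; rewrite s0 // inE ys orbT.
have x0 : 0 <= x by rewrite s0 ?mem_head.
case: k => [|k]; first by rewrite coef0_esymp mul1r mulr1.
have le1 := IHs k.+1 s'0; have := ler_wpM2l x0 (IHs k s'0).
have := mulr_ge0 (mulr_ge0 x0 x0) (coef_esymp_ge0 k s'0).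
by rewrite !coefS_esymp_cons coef0_esymp; move: le1; rewrite -!natr1; lra.
Qed.

End ElementarySymmetric.

Section PowersOfSmallRatio.
Variables (R : realFieldType) (q : R).
Hypotheses (q_gt0 : 0 < q) (q_small : q ^+ 2 + q <= 1).
Variable P : pred nat.

(** [P] serves to omit one exponent; the offset [m] lets inductions peel off the largest power and
    keep a tail of the same shape. *)
Let pows m n := [seq q ^+ i | i <- iota m n & P i].

Let pows_ge0 m n : {in pows m n, forall x, 0 <= x}.
Proof. by move=> _ /mapP[i _ ->]; rewrite exprn_ge0 ?ltW. Qed.

Lemma coef1_esymp_pows m n : (1 - q) * (esymp (pows m n))`_1 <= q ^+ m.
Proof.
rewrite /pows; elim: n m => [|n IHn] m /=.
  by rewrite esymp_nil coef1 mulr0 exprn_ge0 ?ltW.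
have := IHn m.+1; case: (P m) => /=.
  by rewrite coefS_esymp_cons coef0_esymp exprS; lra.
have q_le1 : q <= 1 by move: q_gt0 q_small; nra.
by move=> /le_trans; apply; rewrite exprS ler_piMl // exprn_ge0 ?ltW.
Qed.

(** The full geometric sequence gives equality. When x = q^m is prepended, the induction step
    reduces to (1 - q) e_1 <= q^(m+1) for the tail, which is the geometric bound above. *)
Lemma coef2_esymp_pows m n :
  (1 + q) * (esymp (pows m n))`_2 <= q * (esymp (pows m n))`_1 ^+ 2.
Proof.
rewrite /pows; elim: n m => [|n IHn] m /=.
  by rewrite esymp_nil !coef1 expr0n !mulr0.
have IH := IHn m.+1; case: (P m) => //=.
rewrite !coefS_esymp_cons coef0_esymp.
have := ler_wpM2l (ltW (exprn_gt0 m q_gt0)) (coef1_esymp_pows m.+1 n).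
by move: IH; rewrite /pows !exprS expr0; lra.
Qed.

Lemma esymp_pows_nincr n k :
  (0 < k)%N -> (esymp (pows 0 n))`_k.+1 <= (esymp (pows 0 n))`_k.
Proof.
have e1_le := coef1_esymp_pows 0 n; have e2_le := coef2_esymp_pows 0 n.
have e_ge0 i := coef_esymp_ge0 i (@pows_ge0 0 n).
have eS_le := coefS_esymp_le k (@pows_ge0 0 n).
rewrite expr0 in e1_le.
case: k eS_le => [//|[_|k eS_le]] _.
  have := e_ge0 1%N; have := e_ge0 2%N; move: e1_le e2_le.
  move: (esymp _)`_1 (esymp _)`_2 => e1 e2 e1_le e2_le e2_ge0 e1_ge0.
  have q1 : 0 < 1 - q by move: q_gt0 q_small; nra.
  (* Chain: (1 - q^2) e_2 <= q (1 - q) e_1^2 <= q e_1 <= (1 - q^2) e_1; then cancel 1 - q^2. *)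
  have h1 := ler_wpM2l (ltW q1) e2_le.
  have h2 : q * e1 * ((1 - q) * e1) <= q * e1.
    by rewrite ler_piMr // mulr_ge0 // ltW.
  have h3 : 0 < 1 - q ^+ 2 by move: q_gt0 q_small; nra.
  by rewrite -(ler_pM2l h3); move: h1 h2 (ler_wpM2l e1_ge0 q_small); lra.
(* The hypothesis on q forces q < 2/3, so 1 / (1 - q) < 3, and 3 is at most the factor [k.+3] in
   [eS_le]. *)
have e1_le3 : (esymp (pows 0 n))`_1 <= 3.
  by have := e_ge0 1%N; move: e1_le q_gt0 q_small; nra.
have k3 : (3 : R) <= k.+3%:R by rewrite ler_nat.
have k0 : (0 : R) < k.+3%:R by rewrite ltr0n.
rewrite -(ler_pM2l k0) (le_trans eS_le) // ler_wpM2r //.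
exact: le_trans k3.
Qed.

End PowersOfSmallRatio.

Section InverseVandermonde.
Variables (R : realType) (b : R) (n : nat).
Hypothesis b_gt1 : 1 < b.

Let others (j : nat) := [seq b^-1 ^+ m | m <- iota 0 n & m != j].

(** Lagrange polynomial of the node b^j, scaled to have constant term 1 instead of value 1 at that
    node. *)
Let lagr (j : nat) : {poly R} := esymp [seq - x | x <- others j].

Lemma horner_lagr (j k : nat) : (j < n)%N -> (k < n)%N ->
  ((lagr j).[b ^+ k] == 0) = (k != j).
Proof.
move=> ltjn ltkn; have b0 : 0 < b := lt_trans ltr01 b_gt1.
rewrite /lagr /esymp /others !big_map horner_prod big_filter prodf_seq_eq0.
apply/hasP/idP => [[m _] /andP[mj]|kj]; last first.
  exists k; first by rewrite mem_iota.
  by rewrite kj !hornerE mulNr -exprMn mulVf ?lt0r_neq0 // expr1n subrr.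
rewrite !hornerE mulNr subr_eq0 eq_sym exprVn mulrC.
rewrite -(inj_eq (mulIf (expf_neq0 m (lt0r_neq0 b0)))) mul1r.
rewrite mulfVK ?expf_neq0 ?lt0r_neq0 //.
have b_neq1 : b != 1 by rewrite gt_eqF.
by rewrite (inj_eq (ieexprIn b0 b_neq1)) => /eqP->.
Qed.

Lemma size_lagr (j : nat) : (j < n)%N -> (size (lagr j) <= n)%N.
Proof.
move=> ltjn; apply: leq_trans (size_esymp _) _.
rewrite !size_map size_filter -[X in (_ < X)%N](size_iota 0 n).
rewrite -(count_predC (pred1 j) (iota 0 n)) -[X in (X < _)%N]add0n ltn_add2r.
by rewrite -has_count has_pred1 mem_iota.
Qed.

Lemma coef_lagr (i j : 'I_n) : coef b i j = (lagr j)`_i / (lagr j).[b ^+ j].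
Proof.
pose D : 'M[R]_n := \matrix_(i, j) ((lagr j)`_i / (lagr j).[b ^+ j]).
suff VD : vandermonde (powers b n) *m D = 1%:M.
  have /mulmx1_unit[Vu _] := VD.
  by rewrite /coef -[invmx _]mulmx1 -VD mulKmx // mxE.
apply/matrixP => k l; rewrite !mxE.
(* Row k of the Vandermonde matrix times column l of [D] is the normalized [lagr l] evaluated at
   b^k. *)
under eq_bigr do rewrite !mxE mulrA [_ * _`__]mulrC.
rewrite -mulr_suml -horner_coef_wide ?size_lagr //.
have [->|kl] := eqVneq k l; first by rewrite divff // horner_lagr // eqxx.
by apply/eqP; rewrite mulf_eq0 horner_lagr // kl.
Qed.

Lemma coef_sym (i j : 'I_n) : coef b i j = coef b j i.
Proof.
have VT : (vandermonde (powers b n))^T = vandermonde (powers b n).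
  by apply/matrixP => k l; rewrite !mxE -!exprM mulnC.
by rewrite /coef -[in LHS]VT -trmx_inv mxE.
Qed.

(** The absolute value removes the sign (-1)^i. The denominator depends on j alone, so comparing
    entries of a column amounts to comparing the e_i. *)
Lemma normr_coef (i j : 'I_n) :
  `|coef b i j| = (esymp (others j))`_i / `|(lagr j).[b ^+ j]|.
Proof.
rewrite coef_lagr normrM normfV /lagr coef_esympN normrM normrX normrN1 expr1n.
rewrite mul1r ger0_norm // coef_esymp_ge0 // => _ /mapP[m _ ->].
by rewrite exprn_ge0 // invr_ge0 ltW // (lt_trans ltr01).
Qed.

End InverseVandermonde.

Section GoldenRatio.
Variables (R : realType) (b : R).
Hypothesis hb : golden_ratio R <= b.

Lemma golden_ratio_le_gt1 : 1 < b.
Proof.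
have : 1 < Num.sqrt (5 : R).
  by rewrite -[X in X < _]sqrtr1 ltr_sqrt ?ltr1n ?ltr0n.
by move: hb; rewrite /golden_ratio; lra.
Qed.

Lemma golden_ratio_le_inv : b^-1 ^+ 2 + b^-1 <= 1.
Proof.
have b1 := golden_ratio_le_gt1; have b0 : 0 < b := lt_trans ltr01 b1.
(* The golden ratio is the positive root of x^2 = x + 1; dividing by b^2 then gives the claim. *)
have b2 : 1 + b <= b ^+ 2.
  have s5 : Num.sqrt (5 : R) ^+ 2 = 5 by rewrite sqr_sqrtr.
  have := sqrtr_ge0 (5 : R); move: hb s5; rewrite /golden_ratio.
  by move: (Num.sqrt 5) => s; nra.
rewrite -(ler_pM2l (exprn_gt0 2 b0)) mulr1; apply: le_trans b2.
by rewrite le_eqVlt; apply/orP; left; apply/eqP; field; rewrite gt_eqF.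
Qed.

Variables (n : nat) (hn : (2 <= n)%N).
Let i0 : 'I_n := Ordinal (ltnW hn).
Let i1 : 'I_n := Ordinal hn.

Lemma normr_coef_row01 (i j : 'I_n) :
  `|coef b i j| <= Num.max `|coef b i0 j| `|coef b i1 j|.
Proof.
have b1 := golden_ratio_le_gt1.
have q0 : 0 < b^-1 by rewrite invr_gt0 (lt_trans ltr01).
case: i => [[|i] lti]; rewrite le_max.
  by rewrite (_ : Ordinal lti = i0) ?lexx //; apply: val_inj.
apply/orP; right; rewrite !normr_coef //= ler_wpM2r ?invr_ge0 //.
(* Descends one row at a time until row 1. *)
elim: i {lti} => // i; apply: le_trans.
exact: (@esymp_pows_nincr _ _ q0 golden_ratio_le_inv).
Qed.

Lemma normr_coef01_le11 : `|coef b i0 i1| <= `|coef b i1 i1|.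
Proof.
have b1 := golden_ratio_le_gt1.
have q0 : 0 < b^-1 by rewrite invr_gt0 (lt_trans ltr01).
rewrite !normr_coef //= ler_wpM2r ?invr_ge0 // coef0_esymp.
case: n hn => [//|n' _] /=; rewrite coefS_esymp_cons coef0_esymp expr0 mulr1.
by rewrite lerDr coef_esymp_ge0 // => _ /mapP[m _ ->]; rewrite exprn_ge0 ?ltW.
Qed.

(** The row reduction is used twice, with a transposition in between, so that both indices drop to 0
    or 1. *)
Lemma normr_coef_le (i j : 'I_n) :
  `|coef b i j| <= Num.max `|coef b i0 i0| `|coef b i1 i1|.
Proof.
have le01 := normr_coef01_le11.
have row (k : 'I_n) : `|coef b k i0| <= Num.max `|coef b i0 i0| `|coef b i1 i1|
    /\ `|coef b k i1| <= Num.max `|coef b i0 i0| `|coef b i1 i1|.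
  split; apply: le_trans (normr_coef_row01 _ _) _; rewrite ge_max.
    by rewrite (coef_sym b i1 i0) !le_max lexx le01 orbT.
  by rewrite !le_max lexx le01 !orbT.
apply: le_trans (normr_coef_row01 _ _) _.
by rewrite ge_max !(coef_sym b _ j); have [-> ->] := row j.
Qed.

End GoldenRatio.

Theorem theorem2 (R : realType) (b : R) (n : nat)
    (hb : golden_ratio R <= b) (hn : (2 <= n)%N) :
  maxcoef b n = `|coef b (Ordinal (ltnW hn)) (Ordinal (ltnW hn))| \/
  maxcoef b n = `|coef b (Ordinal hn) (Ordinal hn)|.
Proof.
set i0 := Ordinal (ltnW hn); set i1 := Ordinal hn.
have ub : maxcoef b n <= Num.max `|coef b i0 i0| `|coef b i1 i1|.
  apply: bigmax_le => [|i _]; first by rewrite le_max normr_ge0.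
  apply: bigmax_le => [|j _]; first by rewrite le_max normr_ge0.
  exact: normr_coef_le.
have lb (i : 'I_n) : `|coef b i i| <= maxcoef b n.
  by apply: (bigmax_sup i) => //; apply: (bigmax_sup i).
move: ub; rewrite le_max => /orP[] le; [left|right];
  by apply/le_anti; rewrite le lb.
Qed.
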